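(* Let $k\ge1$ be an integer. Setting $s=p=kx$, $t=r=ky$, $u=(k-1)x+q$, and all other parameters ($a,b,c,d,f,g,h,\ell,w$) equal to $1$ in $\mathcal C$, one has $$\mathcal C(z)=\sum_{n\ge0}\sum_{\sigma\in\mathcal S_n^k}x^{\mathsf{exc}(\sigma)}y^{\mathsf{aexc}(\sigma)}q^{\mathsf{fix}(\sigma)}z^n .$$
   Context: A $k$-colored permutation of $[n]=\{1,\dots,n\}$ is a pair $(a_1a_2\ldots a_n,\ c_1c_2\ldots c_n)$ where $a_1a_2\ldots a_n$ is a permutation of $[n]$ (one-line notation) and each $c_i\in\{0,1,\dots,k-1\}$; the set of these is $\mathcal S_n^k$. For $P=(a_1\ldots a_n,c_1\ldots c_n)\in\mathcal S_n^k$: $\mathsf{exc}(P)$ is the number of $i\le n$ such that $a_i>i$, or $a_i=i$ and $c_i>0$; $\mathsf{aexc}(P)$ is the number of $i\le n$ with $a_i<i$; $\mathsf{fix}(P)$ is the number of $i\le n$ with $a_i=i$ and $c_i=0$. For $n\ge1$, $[n]_{x,y}:=\sum_{i=0}^{n-1}x^{n-1-i}y^{i}$, and $[0]_{x,y}:=0$. For parameters $a,b,c,d,f,g,h,\ell,p,r,s,t,u,w$, $\mathcal C(z)$ is the formal power series in $z$ defined by the continued fraction $$\mathcal C(z)=\cfrac{1}{1-\alpha_0z-\cfrac{\beta_1z^2}{1-\alpha_1z-\cfrac{\beta_2z^2}{\ddots}}},\qquad \alpha_n=u\,w^n+s\,[n]_{a,b}+t\,[n]_{f,g}\ (n\ge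 0),\quad \beta_n=p\,r\,[n]_{c,d}\,[n]_{h,\ell}\ (n\ge 1).$$ *)

(* Defs.v *)
From mathcomp Require Import all_boot all_order all_algebra all_fingroup.

Set Implicit Arguments.
Unset Strict Implicit.
Unset Printing Implicit Defensive.

Import GRing.Theory.
Local Open Scope ring_scope.

(* A formal power series in z is its sequence of coefficients; two series are
   equal when they agree coefficientwise, i.e. in the sense of =1. *)
Definition fps (R : comNzRingType) := nat -> R.

Definition fps_const (R : comNzRingType) (c : R) : fps R :=
  fun n => if n == 0%N then c else 0.

Definition fps_z (R : comNzRingType) : fps R := fun n => (n == 1%N)%:R.

Definition fps_sub (R : comNzRingType) (A B : fps R) : fps R :=
  fun n => A n - B n.

Definition fps_mul (R : comNzRingType) (A B : fps R) : fps R :=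
  fun n => \sum_(i < n.+1) A (n - i)%N * B i.

(* The first n coefficients of the inverse of a series A with A 0 = 1. *)
Fixpoint fps_inv_prefix (R : comNzRingType) (A : fps R) (n : nat) : seq R :=
  if n is m.+1 then
    let s := fps_inv_prefix A m in
    rcons s ((m == 0%N)%:R - \sum_(j < m) A (m - j)%N * s`_j)
  else [::].

(* Meaningful only when A 0 = 1; see fps_mul_inv. *)
Definition fps_inv (R : comNzRingType) (A : fps R) : fps R :=
  fun n => (fps_inv_prefix A n.+1)`_n.

Declare Scope fps_scope.
Delimit Scope fps_scope with fps.
Bind Scope fps_scope with fps.
Notation "c %:S" := (fps_const c) (at level 2, left associativity,
  format "c %:S") : fps_scope.
Notation "''z'" := (fps_z _) (at level 0) : fps_scope.
Notation "A - B" := (fps_sub A B) : fps_scope.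
Notation "A * B" := (fps_mul A B) : fps_scope.
Notation "A ^-1" := (fps_inv A) : fps_scope.

Lemma size_fps_inv_prefix (R : comNzRingType) (A : fps R) n :
  size (fps_inv_prefix A n) = n.
Proof. by elim: n => //= n IH; rewrite size_rcons IH. Qed.

Lemma nth_fps_inv_prefix (R : comNzRingType) (A : fps R) n i :
  (i < n)%N -> (fps_inv_prefix A n)`_i = fps_inv A i.
Proof.
elim: n => // n IH; rewrite ltnS leq_eqVlt => /predU1P[-> //|lt_in].
by rewrite /= nth_rcons size_fps_inv_prefix lt_in IH.
Qed.

Lemma fps_invE (R : comNzRingType) (A : fps R) n :
  fps_inv A n = (n == 0%N)%:R - \sum_(j < n) A (n - j)%N * fps_inv A j.
Proof.
rewrite {1}/fps_inv /= nth_rcons size_fps_inv_prefix ltnn eqxx.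
by congr (_ - _); apply: eq_bigr => j _; rewrite nth_fps_inv_prefix.
Qed.

Lemma fps_mul_inv (R : comNzRingType) (A : fps R) :
  A 0%N = 1 -> (A * A^-1)%fps =1 (1%R%:S)%fps.
Proof.
move=> A0 n; rewrite /fps_mul /fps_const big_ord_recr /= subnn A0 mul1r.
by rewrite [fps_inv A n]fps_invE addrC subrK; case: (n == 0%N).
Qed.

(* jconv alpha beta N i is the finite continued fraction
     1/(1 - alpha_i z - beta_(i+1) z^2/( ... /(1 - alpha_(i+N) z))). *)
Fixpoint jconv (R : comNzRingType) (alpha beta : nat -> R) (N i : nat) : fps R :=
  if N is N'.+1 then
    ((1%R%:S - (alpha i)%:S * 'z
        - (beta i.+1)%:S * ('z * 'z) * jconv alpha beta N' i.+1)^-1)%fps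
  else ((1%R%:S - (alpha i)%:S * 'z)^-1)%fps.

(* The infinite continued fraction is the coefficientwise limit of its
   convergents: by jfrac_limit, the coefficient of z^n is the same in all
   convergents of depth N >= n. *)
Definition jfrac (R : comNzRingType) (alpha beta : nat -> R) : fps R :=
  fun n => jconv alpha beta n 0 n.

Lemma fps_inv_congr (R : comNzRingType) (A B : fps R) m :
  (forall n, (n <= m)%N -> A n = B n) ->
  forall n, (n <= m)%N -> fps_inv A n = fps_inv B n.
Proof.
move=> eqAB; elim/ltn_ind => n IH le_nm; rewrite !fps_invE; congr (_ - _).
apply: eq_bigr => j _; rewrite eqAB ?(leq_trans (leq_subr _ _)) //.
by rewrite IH // (leq_trans (ltnW (ltn_ord j))).
Qed.

Lemma fps_mul_z2 (R : comNzRingType) (b : R) n i :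
  (n - i < 2)%N -> (b%:S * ('z * 'z))%fps (n - i)%N = 0.
Proof.
case: (n - i)%N => [|[|//]] _; rewrite /fps_mul /fps_const /fps_z;
  by rewrite !big_ord_recr !big_ord0 /= ?(mulr0, mul0r, add0r, addr0,
     big_ord_recr, big_ord0).
Qed.

Lemma jconv_step (R : comNzRingType) (alpha beta : nat -> R) N i n :
  (n <= N)%N -> jconv alpha beta N.+1 i n = jconv alpha beta N i n.
Proof.
elim: N i n => [|N IH] i n le_nN.
  apply: (@fps_inv_congr _ _ _ 0%N) => // {le_nN}n; rewrite leqn0 => /eqP->.
  rewrite {1}/fps_sub {2}/fps_mul big_ord_recr big_ord0 /=.
  by rewrite (@fps_mul_z2 _ _ 0 0) // mul0r add0r subr0.
apply: (@fps_inv_congr _ _ _ N.+1) => // {le_nN}n le_nN.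
congr (_ - _); apply: eq_bigr => j _.
case: (ltnP (n - j) 2) => [lt2|ge2]; first by rewrite fps_mul_z2 // !mul0r.
congr (_ * _); apply: IH; rewrite -ltnS (leq_trans _ le_nN) //.
by rewrite -subn_gt0 ltnW.
Qed.

Lemma jfrac_limit (R : comNzRingType) (alpha beta : nat -> R) n N :
  (n <= N)%N -> jconv alpha beta N 0 n = jfrac alpha beta n.
Proof.
elim: N => [|N IH]; first by rewrite leqn0 => /eqP->.
by rewrite leq_eqVlt => /predU1P[-> //|le_nN]; rewrite jconv_step ?IH.
Qed.

Definition brack (R : comNzRingType) (x y : R) (n : nat) : R :=
  \sum_(i < n) x ^+ (n - 1 - i) * y ^+ i.

Record Cparams (R : comNzRingType) := CParams {
  par_a : R; par_b : R; par_c : R; par_d : R; par_f : R; par_g : R; par_h : R;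
  par_l : R; par_p : R; par_r : R; par_s : R; par_t : R; par_u : R; par_w : R }.

Definition Calpha (R : comNzRingType) (P : Cparams R) (n : nat) : R :=
  par_u P * par_w P ^+ n + par_s P * brack (par_a P) (par_b P) n
    + par_t P * brack (par_f P) (par_g P) n.

Definition Cbeta (R : comNzRingType) (P : Cparams R) (n : nat) : R :=
  par_p P * par_r P * brack (par_c P) (par_d P) n
    * brack (par_h P) (par_l P) n.

Definition Cfrac (R : comNzRingType) (P : Cparams R) : fps R :=
  jfrac (Calpha P) (Cbeta P).

(* Positions and values are indexed by {0, ..., n-1} instead of {1, ..., n};
   the statistics only compare values with positions, so the shift is
   harmless. *)
Definition cperm (k n : nat) : finType :=
  ('S_n * {ffun 'I_n -> 'I_k})%type.

Definition cexc (k n : nat) (P : cperm k n) : nat :=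
  #|[set i : 'I_n | (i < P.1 i)%N || (P.1 i == i) && (0 < P.2 i)%N]|.

Definition caexc (k n : nat) (P : cperm k n) : nat :=
  #|[set i : 'I_n | (P.1 i < i)%N]|.

Definition cfix (k n : nat) (P : cperm k n) : nat :=
  #|[set i : 'I_n | (P.1 i == i) && (P.2 i == 0%N :> nat)]|.

(* Main.v *)
Require Import Defs.
From mathcomp Require Import all_boot all_order all_algebra.
From mathcomp Require Import all_fingroup ring.

(** The product of the weights X, Y, Q attached to the excedances,
    anti-excedances and fixed points of a permutation, summed over S_n, is a
    polynomial p_n in (X, Y, Q).  Deleting n+1 from its cycle gives
    p_(n+1) = Q p_n + X Y D p_n, where D is the sum of the three partial
    derivatives; translating X, Y, Q simultaneously by an indeterminate turns D
    into a univariate derivative.  By Leibniz' rule,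
      D^i p_(n+1) = i^2 D^(i-1) p_n + (Q + i (X + Y)) D^i p_n + X Y D^(i+1) p_n,
    a three-term recurrence whose solution at i = 0 is the J-fraction with
    alpha_i = Q + i (X + Y) and beta_i = X Y i^2.  The colours are summed out
    first: this amounts to X = k x, Y = k y, Q = (k - 1) x + q. *)

Set Implicit Arguments.
Unset Strict Implicit.
Unset Printing Implicit Defensive.

Import GRing.Theory.
Local Open Scope ring_scope.

(** * Algebra of formal power series *)

Section FpsMul.
Variable R : comNzRingType.
Implicit Types A B C G : fps R.

Lemma fps_mul_congr A A' B B' n :
  (forall m, (m <= n)%N -> A m = A' m) -> (forall m, (m <= n)%N -> B m = B' m) ->
  fps_mul A B n = fps_mul A' B' n.
Proof.
move=> eqA eqB; apply: eq_bigr => i _.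
by rewrite eqA ?leq_subr // eqB // -ltnS ltn_ord.
Qed.

(** Truncation to polynomials lets commutativity and associativity be inherited from [{poly R}]. *)
Lemma coef_mul_trunc A B N n : (n < N)%N ->
  ((\poly_(i < N) A i) * (\poly_(i < N) B i))`_n = fps_mul A B n.
Proof.
move=> lt_nN; rewrite coefMr; apply: eq_bigr => i _; rewrite !coef_poly.
rewrite (leq_ltn_trans (leq_subr _ _) lt_nN).
by rewrite (leq_ltn_trans _ lt_nN) // -ltnS ltn_ord.
Qed.

Lemma fps_mulC A B : fps_mul A B =1 fps_mul B A.
Proof. by move=> n; rewrite -!(coef_mul_trunc _ _ (ltnSn n)) mulrC. Qed.

Lemma fps_mulA A B C : fps_mul A (fps_mul B C) =1 fps_mul (fps_mul A B) C.
Proof.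
move=> n; rewrite -!(coef_mul_trunc _ _ (ltnSn n)).
set p := \poly_(i < n.+1) A i; set r := \poly_(i < n.+1) C i.
transitivity (p * ((\poly_(i < n.+1) B i) * r))`_n.
  rewrite !coefMr; apply: eq_bigr => i _.
  by rewrite coef_mul_trunc // coef_poly ltn_ord.
rewrite mulrA !coefM; apply: eq_bigr => i _.
by rewrite coef_mul_trunc // coef_poly ltn_ord.
Qed.

Lemma fps_mulBl A B C n :
  fps_mul (fps_sub A B) C n = fps_mul A C n - fps_mul B C n.
Proof.
by rewrite /fps_mul -sumrB; apply: eq_bigr => i _; rewrite mulrBl.
Qed.

Lemma fps_mul_constl (c : R) A n : fps_mul (fps_const c) A n = c * A n.
Proof.
rewrite /fps_mul big_ord_recr /= subnn /fps_const /= big1 ?add0r // => i _.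
by rewrite subn_eq0 leqNgt ltn_ord mul0r.
Qed.

Lemma fps_mul_z0 A : fps_mul (fps_z R) A 0%N = 0.
Proof. by rewrite /fps_mul big_ord1 mul0r. Qed.

Lemma fps_mul_zS A n : fps_mul (fps_z R) A n.+1 = A n.
Proof.
rewrite fps_mulC /fps_mul /fps_z 2!big_ord_recl /= mulr0 add0r mulr1.
by rewrite big1 => [|i _]; rewrite ?addr0 ?subn1 // mulr0.
Qed.

(** Division is needed only up to order [m], since a convergent satisfies its product identity only
    to finite order. *)
Lemma fps_mul_inv_eq A G C m :
  A 0%N = 1 -> (forall n, (n <= m)%N -> fps_mul A G n = C n) ->
  forall n, (n <= m)%N -> G n = fps_mul (fps_inv A) C n.
Proof.
move=> A0 eqC n le_nm.
transitivity (fps_mul (fps_mul (fps_inv A) A) G n).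
  rewrite -[LHS]mul1r -fps_mul_constl; apply: fps_mul_congr => // i _.
  by rewrite fps_mulC fps_mul_inv.
rewrite -fps_mulA; apply: fps_mul_congr => // i le_in.
by rewrite eqC // (leq_trans le_in).
Qed.

End FpsMul.

(** * J-fractions from three-term recurrences *)

Section JacobiRecurrence.
Variables (R : comNzRingType) (alpha beta u d : nat -> R) (G : nat -> fps R).
Hypothesis betaS : forall i, beta i.+1 = u i * d i.+1.
Hypothesis d0 : d 0%N = 0.
Hypothesis G0 : forall i, G i 0%N = (i == 0%N)%:R.
Hypothesis GS : forall i n,
  G i n.+1 = d i * G i.-1 n + alpha i * G i n + u i * G i.+1 n.

Let lin i := fps_sub (fps_const 1) (fps_mul (fps_const (alpha i)) (fps_z R)).
Let jden N i : fps R :=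
  if N is N'.+1 then
    fps_sub (lin i)
      (fps_mul (fps_mul (fps_const (beta i.+1)) (fps_mul (fps_z R) (fps_z R)))
         (jconv alpha beta N' i.+1))
  else lin i.

Lemma jconvE N i : jconv alpha beta N i = fps_inv (jden N i).
Proof. by case: N. Qed.

Lemma mul_lin0 i : fps_mul (lin i) (G i) 0%N = G i 0%N.
Proof.
by rewrite fps_mulBl fps_mul_constl mul1r -fps_mulA fps_mul_constl fps_mul_z0
  mulr0 subr0.
Qed.

Lemma mul_linS i n :
  fps_mul (lin i) (G i) n.+1 = d i * G i.-1 n + u i * G i.+1 n.
Proof.
rewrite fps_mulBl fps_mul_constl mul1r -fps_mulA fps_mul_constl fps_mul_zS GS.
by ring.
Qed.

Lemma jden0 N i : jden N i 0%N = 1.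
Proof.
have lin0 : lin i 0%N = 1.
  by rewrite /lin /fps_sub fps_mul_constl /fps_z /= mulr0 subr0.
case: N => [|N] //=; rewrite /fps_sub lin0.
by rewrite -fps_mulA fps_mul_constl -fps_mulA fps_mul_z0 mulr0 subr0.
Qed.

(** The right-hand side is the series G_i(0) + d_i z G_(i-1). One level up, the induction hypothesis
    gives G_(i+1) = d_(i+1) z J G_i to the order needed; this turns the term u_i z G_(i+1) of the
    recurrence into beta_(i+1) z^2 J G_i, which is the tail subtracted in [jden]. *)
Lemma jden_mul N i n : (n <= N.+1)%N ->
  fps_mul (jden N i) (G i) n = if n is m.+1 then d i * G i.-1 m else G i 0%N.
Proof.
elim: N i n => [|N IH] i n le_nN.
  case: n le_nN => [|[|//]] _; first exact: mul_lin0.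
  by rewrite [LHS]mul_linS (G0 i.+1) mulr0 addr0.
rewrite fps_mulBl.
set J := jconv _ _ _ _; rewrite -2!fps_mulA fps_mul_constl -fps_mulA.
(* The tail carries a factor z^2, so orders 0 and 1 are treated apart. *)
case: n le_nN => [|n] le_nN; first by rewrite mul_lin0 fps_mul_z0 mulr0 subr0.
rewrite mul_linS fps_mul_zS.
case: n le_nN => [|n] le_nN; first by rewrite fps_mul_z0 (G0 i.+1) !mulr0 subr0 addr0.
rewrite fps_mul_zS betaS -mulrA.
suff -> : d i.+1 * fps_mul J (G i) n = G i.+1 n.+1 by rewrite addrK.
rewrite (fps_mul_inv_eq (jden0 N i.+1) (IH i.+1) (n := n.+1)) //.
rewrite -jconvE -/J /fps_mul [RHS]big_ord_recl G0 mulr0 add0r mulr_sumr.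
by apply: eq_bigr => m _; rewrite subSS mulrCA.
Qed.

(** At level 0, [d0] reduces the right-hand side of [jden_mul] to the constant 1, so [G 0] is the
    inverse of the denominator. *)
Lemma jfrac_recurrence : jfrac alpha beta =1 G 0%N.
Proof.
move=> n; rewrite /jfrac jconvE.
rewrite (fps_mul_inv_eq (jden0 n 0%N) (@jden_mul n 0) (n := n)) //.
rewrite fps_mulC -[LHS]mul1r -fps_mul_constl.
by apply: fps_mul_congr => // -[|m] _; rewrite ?G0 // d0 mul0r.
Qed.

End JacobiRecurrence.

(** * Inserting the largest element into a permutation *)

Section PermutationSum.
Variable R : comNzRingType.

Definition arc_weight (X Y Q : R) (i j : nat) : R :=
  if (i < j)%N then X else if (j < i)%N then Y else Q.

Definition perm_sum (X Y Q : R) (n : nat) : R :=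
  \sum_(s : 'S_n) \prod_(i < n) arc_weight X Y Q i (s i).

(** Products act from left to right: [ord_max] is inserted between [p.1] and its image in the cycle,
    or becomes a fixed point when [p.1] is [ord_max]. *)
Definition insert_perm n (p : 'I_n.+1 * 'S_n) : 'S_n.+1 :=
  (tperm ord_max p.1 * lift_perm ord_max ord_max p.2)%g.

(** Injectivity suffices by cardinality: [p.1] is the preimage of [ord_max], and [p.2] follows by
    cancelling the transposition. *)
Lemma insert_perm_bij n : bijective (@insert_perm n).
Proof.
apply: inj_card_bij => [[k s] [l t] eq_kl|]; last first.
  by rewrite card_prod card_ord !card_Sn factS.
have max_at (p : 'I_n.+1 * 'S_n) : insert_perm p p.1 = ord_max.
  by rewrite permM tpermR lift_perm_id.
have eqk : k = l.
  apply: (@perm_inj _ (insert_perm (k, s))).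
  by rewrite [LHS](max_at (k, s)) eq_kl [RHS](max_at (l, t)).
rewrite -{l}eqk in eq_kl *; congr (_, _).
have {}eq_kl := mulgI _ _ _ eq_kl; apply/permP => i.
apply: (@lift_inj _ ord_max).
have := congr1 (fun r : 'S_n.+1 => r (lift ord_max i)) eq_kl.
by rewrite !lift_perm_lift.
Qed.

(** Insertion after [j] replaces the arc from [j] to [s j] by an excedance into the maximum and an
    anti-excedance out of it, whence [X * Y] and the omitted factor; a fixed maximum contributes
    [Q]. *)
Lemma perm_sumS (X Y Q : R) n :
  perm_sum X Y Q n.+1 = Q * perm_sum X Y Q n
    + X * Y * \sum_(s : 'S_n) \sum_(j < n)
        \prod_(i < n | i != j) arc_weight X Y Q i (s i).
Proof.
have liftE (i : 'I_n) : lift ord_max i = i :> nat by rewrite lift_max.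
have widE (i : 'I_n) : widen_ord (leqnSn n) i = lift ord_max i.
  by apply: val_inj; exact/esym/liftE.
rewrite /perm_sum (reindex (@insert_perm n)) /=; last first.
  exact/onW_bij/insert_perm_bij.
rewrite -(pair_bigA _ (fun k s => \prod_(i < n.+1)
  arc_weight X Y Q i (insert_perm (k, s) i))) /= exchange_big /=.
rewrite !mulr_sumr -big_split /=; apply: eq_bigr => s _.
rewrite big_ord_recr /= addrC; congr (_ + _).
  rewrite big_ord_recr /= mulrC /insert_perm /= tperm1 mul1g lift_perm_id.
  congr (_ * _); first by rewrite /arc_weight ltnn.
  apply: eq_bigr => i _.
  by rewrite widE lift_perm_lift !liftE.
rewrite mulr_sumr; apply: eq_bigr => j _.
rewrite widE big_ord_recr /= (bigD1 j) //= widE /insert_perm /=.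
rewrite !permM tpermR tpermL lift_perm_id lift_perm_lift.
rewrite !liftE.
have -> : arc_weight X Y Q j (@ord_max n) = X by rewrite /arc_weight ltn_ord.
have -> : arc_weight X Y Q n (s j) = Y.
  by rewrite /arc_weight ltnNge ltnW //= ltn_ord.
rewrite mulrAC; congr (_ * _).
apply: eq_bigr => i ne_ij.
rewrite widE permM tpermD ?lift_perm_lift ?liftE ?neq_lift //.
by rewrite (inj_eq (@lift_inj _ _)) eq_sym.
Qed.

End PermutationSum.

Lemma deriv_prod (R : comNzRingType) (I : finType) (F : I -> {poly R}) :
  (\prod_i F i)^`() = \sum_j (F j)^`() * \prod_(i | i != j) F i.
Proof.
(* Induction runs over duplicate-free lists, so that the head differs from every later index. *)
elim: (index_enum I) (index_enum_uniq I) => [|k r IH] /=.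
  by rewrite !big_nil -polyC1 derivC.
case/andP=> k_notin_r /IH{}IH.
rewrite !big_cons eqxx derivM IH mulr_sumr; congr (_ * _ + _).
  rewrite [RHS]big_seq_cond [LHS]big_seq; apply: eq_bigl => i.
  by case: eqVneq => [->|]; rewrite ?andbT // (negPf k_notin_r).
rewrite !big_seq; apply: eq_bigr => j j_in_r; rewrite big_cons.
have [eq_kj | _] := eqVneq k j; first by rewrite eq_kj j_in_r in k_notin_r.
by rewrite mulrCA.
Qed.

(** * Derivatives of the translated sum *)

Section ShiftedSum.
Variables (R : comNzRingType) (X Y Q : R).

Let sX : {poly R} := X%:P + 'X.
Let sY : {poly R} := Y%:P + 'X.
Let sQ : {poly R} := Q%:P + 'X.

Definition shifted_sum n : {poly R} := perm_sum sX sY sQ n.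

(** Each translated weight has derivative 1, so the derivative of a product of weights is the sum
    with one arc omitted from [perm_sumS]. *)
Lemma shifted_sumS n :
  shifted_sum n.+1 = sQ * shifted_sum n + sX * sY * (shifted_sum n)^`().
Proof.
rewrite /shifted_sum perm_sumS; congr (_ + _ * _).
rewrite raddf_sum /=; apply: eq_bigr => s _; rewrite deriv_prod.
apply: eq_bigr => j _; rewrite -[LHS]mul1r; congr (_ * _).
by rewrite /arc_weight; do 2?case: ifP => _; rewrite derivD derivC derivX add0r.
Qed.

(** Differentiating case i, the middle coefficient contributes 2i + 1, completing i^2 to (i + 1)^2,
    and [sX * sY] contributes one more [sX + sY]. *)
Lemma derivn_shifted_sumS n i :
  (shifted_sum n.+1)^`(i) = (i * i)%:R * (shifted_sum n)^`(i.-1)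
    + (sQ + i%:R * (sX + sY)) * (shifted_sum n)^`(i)
    + sX * sY * (shifted_sum n)^`(i.+1).
Proof.
elim: i => [|i IH]; first by rewrite shifted_sumS !derivn0 derivn1; ring.
(* Integer coefficients become constant polynomials, a form [derivE] handles. *)
rewrite derivnS IH; have -> : (i * i)%:R * (shifted_sum n)^`(i.-1) =
  (i * i)%:R%:P * (shifted_sum n)^`(i.-1) by rewrite -polyC_natr.
rewrite -polyC_natr !derivE -!derivnS.
(* For i = 0 the orders 1 and 0 differ, but the factor [i * i] vanishes. *)
have -> : (i * i)%:R%:P * (shifted_sum n)^`(i.-1.+1) =
   (i * i)%:R * (shifted_sum n)^`(i) :> {poly R}.
  by case: i {IH} => [|i]; rewrite ?mul0r ?polyC0 ?mul0r ?polyC_natr.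
rewrite polyC_natr /=; ring.
Qed.

Lemma jfrac_perm_sum (alpha beta : nat -> R) :
  (forall i, alpha i = Q + i%:R * (X + Y)) ->
  (forall i, beta i = X * Y * (i * i)%:R) ->
  jfrac alpha beta =1 perm_sum X Y Q.
Proof.
move=> alphaE betaE.
(* Evaluation at 0 undoes the translation. *)
pose G i : fps R := fun n => (shifted_sum n)^`(i).[0].
move=> n; have -> : perm_sum X Y Q n = G 0%N n.
  rewrite /G derivn0 /shifted_sum /perm_sum horner_sum; apply: eq_bigr => s _.
  rewrite horner_prod; apply: eq_bigr => i _; rewrite /arc_weight.
  by do 2?case: ifP => _; rewrite !hornerE.
(* [beta] splits into the coefficient [X * Y] of the next derivative and the coefficient i^2 of the
   previous one, which vanishes at 0. *)
apply: (@jfrac_recurrence R _ _ (fun=> X * Y) (fun i => (i * i)%:R)) => //.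
  move=> i; rewrite /G.
  have -> : shifted_sum 0 = 1%:P.
    rewrite /shifted_sum /perm_sum.
    under eq_bigr do rewrite big_ord0.
    by rewrite sumr_const card_Sn.
  by case: i => [|i]; rewrite ?derivn0 ?hornerC // derivnC /= ?hornerC.
move=> i m; rewrite /G alphaE derivn_shifted_sumS -!polyC_natr !hornerE.
by rewrite /= addr0.
Qed.

End ShiftedSum.

(** The weight is a product over positions whose colours are independent, so they are summed
    position by position: k equal terms off the diagonal, and on it [q] for colour 0 and [x] for
    each of the k - 1 others. *)
Lemma cperm_sum (R : comNzRingType) (x y q : R) (k n : nat) : (1 <= k)%N ->
  \sum_(sigma : cperm k n) x ^+ cexc sigma * y ^+ caexc sigma * q ^+ cfix sigma
  = perm_sum (k%:R * x) (k%:R * y) ((k%:R - 1) * x + q) n.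
Proof.
move=> k_gt0; pose v (i j c : nat) : R :=
  if (i < j)%N then x else if (j < i)%N then y else if (0 < c)%N then x else q.
transitivity (\sum_(sigma : 'S_n * {ffun 'I_n -> 'I_k})
    \prod_(i < n) v i (sigma.1 i) (sigma.2 i)).
  apply: eq_bigr => -[s c] _; rewrite /cexc /caexc /cfix /=.
  have expE (A : {set 'I_n}) (a : R) :
      a ^+ #|A| = \prod_i (if i \in A then a else 1).
    by rewrite -prodr_const big_mkcond.
  rewrite !expE -!big_split /=; apply: eq_bigr => i _.
  rewrite !inE /v -(inj_eq val_inj) /= lt0n.
  by case: ltngtP => _; case: eqP => _ /=; rewrite ?mul1r ?mulr1.
rewrite -(pair_bigA _ (fun (s : 'S_n) (c : {ffun 'I_n -> 'I_k}) =>
  \prod_(i < n) v i (s i) (c i))) /=.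
apply: eq_bigr => s _.
rewrite -(bigA_distr_bigA (fun (i : 'I_n) (c : 'I_k) => v i (s i) c)) /=.
apply: eq_bigr => i _; rewrite /arc_weight /v.
case: ifP => _; first by rewrite sumr_const card_ord mulr_natl.
case: ifP => _; first by rewrite sumr_const card_ord mulr_natl.
case: k k_gt0 {v} => // k _; rewrite big_ord_recl /= sumr_const card_ord.
by rewrite -[k.+1]addn1 natrD addrK mulr_natl addrC.
Qed.

Theorem corollary7 (R : comNzRingType) (x y q : R) (k : nat) (hk : (1 <= k)%N) :
  Cfrac {| par_a := 1; par_b := 1; par_c := 1; par_d := 1;
           par_f := 1; par_g := 1; par_h := 1; par_l := 1;
           par_p := k%:R * x; par_r := k%:R * y;
           par_s := k%:R * x; par_t := k%:R * y;
           par_u := (k%:R - 1) * x + q; par_w := 1 |}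
  =1 (fun n : nat => \sum_(sigma : cperm k n)
        x ^+ cexc sigma * y ^+ caexc sigma * q ^+ cfix sigma).
Proof.
move=> n; rewrite cperm_sum //.
have brack1 m : brack 1 1 m = m%:R :> R.
  rewrite /brack; under eq_bigr do rewrite !expr1n mulr1.
  by rewrite sumr_const card_ord.
by apply: jfrac_perm_sum => i; rewrite /Calpha /Cbeta /= !brack1 ?expr1n; ring.
Qed.
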